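(* Let $(X,d)$ be a non-elementary $\delta$-hyperbolic space and $\Gamma$ a group acting properly by isometries on $X$ with $\operatorname{diam}(\Gamma\backslash X)\le D$. Put $M_0=\max\big(20(\frac{D}{\delta}+2),\,720\big)$. Then at least one of the following holds: (a) $\operatorname{Ent}(X,d)>\frac{1}{750\,\delta}$; (b) $\ell(\gamma)>3^{-34}\,\delta\,M_0\,e^{-\frac{4}{29}M_0}$ for every element $\gamma\in\Gamma^*$ which is not of finite order.
   Context: A $\delta$-hyperbolic space is a geodesic proper metric space all of whose geodesic triangles are $\delta$-thin (tripod definition: for a triangle with vertices $x,y,z$, the tripod with edge lengths the Gromov products $(y|z)_x=\frac12(d(x,y)+d(x,z)-d(y,z))$ etc., and the map to it isometric on sides and sending vertices to ends; points with the same image are at distance $\le\delta$). Non-elementary: Gromov boundary has at least three points. Proper action: $\{\gamma:d(x,\gamma x)\le R\}$ finite. $\Gamma^*=\Gamma\setminus\{e\}$; $\bar d(\Gamma x,\Gamma y)=\inf_\gamma d(x,\gamma y)$ is the quotient distance. $\ell(\gamma)=\lim_k\frac1kd(x,\gamma^kx)$. $\operatorname{Ent}(X,d)=\liminf_{R\to\infty}\frac1R\ln\#\{\gamma\in\Gamma:d(x,\gamma x)<R\}$. *)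

(* Defs.v *)
Set Implicit Arguments.
From Stdlib Require Import Reals Lra List.
Open Scope R_scope.

Section Metric.
Context {X : Type}.
Variable d : X -> X -> R.

Definition is_metric : Prop :=
  (forall x y, 0 <= d x y) /\
  (forall x y, d x y = 0 <-> x = y) /\
  (forall x y, d x y = d y x) /\
  (forall x y z, d x z <= d x y + d y z).

(** g : [0, d x y] -> X is a geodesic segment from x to y
    (only the values on [0, d x y] matter). *)
Definition geod_seg (g : R -> X) (x y : X) : Prop :=
  g 0 = x /\ g (d x y) = y /\
  forall s t, 0 <= s <= d x y -> 0 <= t <= d x y -> d (g s) (g t) = Rabs (s - t).

Definition geodesic_space : Prop :=
  forall x y, exists g, geod_seg g x y.

Definition proper_space : Prop :=
  forall (o : X) (r : R) (u : nat -> X),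
    (forall n, d o (u n) <= r) ->
    exists (phi : nat -> nat) (y : X),
      (forall n, (phi n < phi (S n))%nat) /\
      Un_cv (fun n => d (u (phi n)) y) 0 /\ d o y <= r.

Definition gprod (x y z : X) : R := (d x y + d x z - d y z) / 2.

(** Tripod thinness of the geodesic triangle with sides
    gxy : x -> y, gyz : y -> z, gzx : z -> x: two points with the same image
    in the tripod are at distance <= delta.  Points on sides issued from the
    same vertex at the same distance t from it (t at most the Gromov product
    at that vertex) have the same image. *)
Definition tripod_thin (delta : R) (x y z : X) (gxy gyz gzx : R -> X) : Prop :=
  (forall t, 0 <= t <= gprod x y z -> d (gxy t) (gzx (d z x - t)) <= delta) /\
  (forall t, 0 <= t <= gprod y z x -> d (gyz t) (gxy (d x y - t)) <= delta) /\
  (forall t, 0 <= t <= gprod z x y -> d (gzx t) (gyz (d y z - t)) <= delta).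

Definition delta_thin_triangles (delta : R) : Prop :=
  forall x y z gxy gyz gzx,
    geod_seg gxy x y -> geod_seg gyz y z -> geod_seg gzx z x ->
    tripod_thin delta x y z gxy gyz gzx.

Definition hyperbolic_space (delta : R) : Prop :=
  is_metric /\ geodesic_space /\ proper_space /\ delta_thin_triangles delta.

(** Gromov boundary: sequences converging at infinity, modulo equivalence. *)
Definition conv_at_infinity (o : X) (u : nat -> X) : Prop :=
  forall K, exists N, forall n m, (N <= n)%nat -> (N <= m)%nat -> K <= gprod o (u n) (u m).

Definition equiv_at_infinity (o : X) (u v : nat -> X) : Prop :=
  forall K, exists N, forall n m, (N <= n)%nat -> (N <= m)%nat -> K <= gprod o (u n) (v m).

(** Non-elementary: the Gromov boundary has at least three points. *)
Definition non_elementary : Prop :=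
  exists (o : X) (u v w : nat -> X),
    conv_at_infinity o u /\ conv_at_infinity o v /\ conv_at_infinity o w /\
    ~ equiv_at_infinity o u v /\ ~ equiv_at_infinity o v w /\
    ~ equiv_at_infinity o u w.

End Metric.

Section Group.
Context {G : Type}.
Variable mul : G -> G -> G.
Variable inv : G -> G.
Variable e : G.

Definition is_group : Prop :=
  (forall a b c, mul a (mul b c) = mul (mul a b) c) /\
  (forall a, mul e a = a) /\ (forall a, mul a e = a) /\
  (forall a, mul (inv a) a = e) /\ (forall a, mul a (inv a) = e).

Fixpoint gpow (g : G) (n : nat) : G :=
  match n with O => e | S k => mul g (gpow g k) end.

Definition finite_order (g : G) : Prop :=
  exists n, (1 <= n)%nat /\ gpow g n = e.

Context {X : Type}.
Variable d : X -> X -> R.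
Variable act : G -> X -> X.

Definition isometric_action : Prop :=
  (forall x, act e x = x) /\
  (forall g h x, act (mul g h) x = act g (act h x)) /\
  (forall g x y, d (act g x) (act g y) = d x y).

Definition proper_action : Prop :=
  forall x (Rr : R), exists l : list G, forall g, d x (act g x) <= Rr -> In g l.

(** diam(Gamma\X) <= D, where the quotient distance is
    dbar(Gx, Gy) = inf_g d(x, g y):  inf <= D  written out. *)
Definition quotient_diam_le (D : R) : Prop :=
  forall x y eps, 0 < eps -> exists g, d x (act g y) < D + eps.

Definition orbit_count (x : X) (Rr : R) (n : nat) : Prop :=
  exists l : list G, NoDup l /\ length l = n /\
    (forall g, In g l <-> d x (act g x) < Rr).

(** Ent(X,d) > c, where Ent = liminf_{R -> oo} (1/R) ln #{g : d(x,g x) < R}: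
    liminf f > c  iff  exists c' > c and R0 with f R >= c' for all R >= R0. *)
Definition entropy_gt (x : X) (c : R) : Prop :=
  exists c' R0, c < c' /\
    forall Rr n, R0 <= Rr -> orbit_count x Rr n -> c' <= ln (INR n) / Rr.

Definition transl_length_gt (x : X) (g : G) (c : R) : Prop :=
  exists l, Un_cv (fun k => d x (act (gpow g (S k)) x) / INR (S k)) l /\ c < l.

End Group.

(* Main.v *)
(** Suppose that [g] has infinite order and a very small translation length [l].
    Since [g] has unbounded orbits, there are segments [x1, x2] with
    [x2 = g^n x1] as long as we wish, and deep inside such a segment every
    [g^k], [k <= m], moves points by [k l] up to a multiple of [delta].  By
    cocompactness this forces [l > 0].  Let [2^I] be the first power of two with
    [2^I l >= 10 delta]; the bound on [l] makes [I] large, at least [M0 / 29].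

    As the boundary has three points and the action is cocompact, some geodesic
    leaves the segment transversally, at a point [p], towards a point [y] at any
    prescribed distance from [p].  A power of [g] with translation length
    at least [10 delta] moves [y] into another direction seen from [p].  Since
    [(y|f^2 y)_p >= (y|f y)_p - O(delta)] when [f] moves [p] by [O(delta)],
    repeated doubling of [k] shows that [(y|g^k y)_p = O(I delta)] for
    [0 < k < 2^I].  Choose [w] with [w p] close to [y], where [d(p,y)] is a large
    multiple of [I delta + D].  The elements [g^k w] play ping-pong: they send [p]
    in different directions, while all their inverses send it near [w^-1 p].
    Half of them thus generate a free semigroup, so that the entropy is at least
    [(I - 1) ln 2 / O(I delta + D)], which exceeds [1 / (750 delta)]. *)
Require Import Defs.
From Stdlib Require Import Reals Lra Lia ZArith List Classical.
Open Scope R_scope.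

(** * Gromov products, the four-point inequality and quasi-axes of isometries *)

Section HyperbolicMetric.
Context {X : Type} {d : X -> X -> R} {delta : R}.
Context (metric : is_metric d).

Lemma metric_nonneg x y : 0 <= d x y.
Proof. apply metric. Qed.

Lemma metric_refl x : d x x = 0.
Proof. now apply metric. Qed.

Lemma metric_sym x y : d x y = d y x.
Proof. apply metric. Qed.

Lemma metric_tri x y z : d x z <= d x y + d y z.
Proof. apply metric. Qed.

Lemma gprod_sym w x y : gprod d w x y = gprod d w y x.
Proof. unfold gprod. rewrite (metric_sym x y). lra. Qed.

Lemma gprod_nonneg w x y : 0 <= gprod d w x y.
Proof. unfold gprod. pose proof (metric_tri x w y). rewrite (metric_sym x w) in *. lra. Qed.

Lemma gprod_le_l w x y : gprod d w x y <= d w x.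
Proof. unfold gprod. pose proof (metric_tri w x y). lra. Qed.

Lemma gprod_le_r w x y : gprod d w x y <= d w y.
Proof. rewrite gprod_sym. apply gprod_le_l. Qed.

Lemma gprod_move_base w w' x y : gprod d w x y <= gprod d w' x y + d w w'.
Proof.
  unfold gprod. pose proof (metric_tri w w' x). pose proof (metric_tri w w' y). lra.
Qed.

Lemma gprod_move_l w x x' y : gprod d w x y <= gprod d w x' y + d x x'.
Proof.
  unfold gprod. pose proof (metric_tri w x' x). pose proof (metric_tri x' x y).
  rewrite (metric_sym x' x) in *. lra.
Qed.

Lemma gprod_move_r w x y y' : gprod d w x y <= gprod d w x y' + d y y'.
Proof. rewrite !(gprod_sym w x). apply gprod_move_l. Qed.

Lemma gprod_split p q x : gprod d p q x + gprod d q p x = d p q.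
Proof. unfold gprod. rewrite (metric_sym q p). lra. Qed.

Lemma gprod_isometry (f : X -> X) (isom : forall x y, d (f x) (f y) = d x y) w x y :
  gprod d (f w) (f x) (f y) = gprod d w x y.
Proof. unfold gprod. now rewrite !isom. Qed.

(** Gromov's inequality [(x|z)_w >= min((x|y)_w, (y|z)_w) - delta]; as a disjunction, each use is a
    case split for [lra]. *)
Definition four_point : Prop := forall w x y z,
  gprod d w x y <= gprod d w x z + delta \/ gprod d w y z <= gprod d w x z + delta.

Definition interpolating : Prop := forall x y t, 0 <= t <= d x y ->
  exists p, d x p = t /\ d p y = d x y - t.

Lemma geodesic_interpolating : geodesic_space d -> interpolating.
Proof.
  intros geod x y t Ht. destruct (geod x y) as (g & g0 & g1 & iso).
  pose proof (metric_nonneg x y). exists (g t). split.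
  - rewrite <- g0 at 1. rewrite iso by lra. rewrite Rabs_left1; lra.
  - rewrite <- g1 at 1. rewrite iso by lra. rewrite Rabs_left1; lra.
Qed.

Lemma geod_seg_reverse g x y : geod_seg d g x y -> geod_seg d (fun t => g (d x y - t)) y x.
Proof.
  intros (g0 & g1 & iso). unfold geod_seg. rewrite (metric_sym y x). repeat split.
  - now rewrite Rminus_0_r.
  - now rewrite Rminus_diag.
  - intros s t Hs Ht. rewrite iso by lra. rewrite <- Rabs_Ropp. f_equal. lra.
Qed.

Lemma thin_rays w x y gx gy t :
  geodesic_space d -> delta_thin_triangles d delta ->
  geod_seg d gx w x -> geod_seg d gy w y -> 0 <= t <= gprod d w x y ->
  d (gx t) (gy t) <= delta.
Proof.
  intros geod thin Hx Hy Ht. destruct (geod x y) as [gxy Hxy].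
  destruct (thin _ _ _ _ _ _ Hx Hxy (geod_seg_reverse _ _ _ Hy)) as [T _].
  specialize (T t Ht). cbv beta in T. rewrite (metric_sym y w) in T.
  now replace (d w y - (d w y - t)) with t in T by lra.
Qed.

(** Let [t] be the smaller of the two products. At distance [t] from [w] the geodesics to [x] and
    [z] are both within [delta] of the one to [y], so [d x z <= d w x + d w z - 2 t + 2 delta], and
    the constant stays [delta]. *)
Lemma thin_four_point :
  geodesic_space d -> delta_thin_triangles d delta -> four_point.
Proof.
  intros geod thin w x y z.
  destruct (Rle_or_lt (gprod d w x y) (gprod d w x z + delta)) as [|H1]; [now left|].
  destruct (Rle_or_lt (gprod d w y z) (gprod d w x z + delta)) as [|H2]; [now right|].
  exfalso.
  destruct (geod w x) as [gx Hx], (geod w y) as [gy Hy], (geod w z) as [gz Hz].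
  set (t := Rmin (gprod d w x y) (gprod d w y z)).
  assert (Hlt : gprod d w x z + delta < t) by (now apply Rmin_glb_lt).
  assert (t <= gprod d w x y) by apply Rmin_l.
  assert (t <= gprod d w y z) by apply Rmin_r.
  assert (0 <= t) by (apply Rmin_glb; apply gprod_nonneg).
  assert (A1 : d (gx t) (gy t) <= delta) by (eapply (thin_rays w x y); eauto; lra).
  assert (A2 : d (gy t) (gz t) <= delta) by (eapply (thin_rays w y z); eauto; lra).
  pose proof (gprod_le_l w x y). pose proof (gprod_le_r w y z).
  destruct Hx as (_ & x1 & isox), Hz as (_ & z1 & isoz).
  assert (B1 : d x (gx t) = d w x - t).
  { rewrite <- x1 at 1. rewrite isox by lra. rewrite Rabs_right; lra. }
  assert (B2 : d (gz t) z = d w z - t).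
  { rewrite <- z1 at 1. rewrite isoz by lra. rewrite Rabs_left1; lra. }
  pose proof (metric_tri x (gx t) z). pose proof (metric_tri (gx t) (gz t) z).
  pose proof (metric_tri (gx t) (gy t) (gz t)).
  unfold gprod in Hlt. lra.
Qed.

Context (delta_pos : 0 < delta) (H4 : four_point).

Lemma four_point_dist w x y z :
  d w y + d x z <= d x y + d w z + 2 * delta \/ d w y + d x z <= d w x + d y z + 2 * delta.
Proof. destruct (H4 w x y z) as [H | H]; unfold gprod in H; lra. Qed.

(** [c] is the point between [u] and [v] sent to the centre of the tripod; the four-point inequality
    makes [w] lie in a third direction seen from [c]. *)
Lemma tripod_center (interp : interpolating) u v w :
  exists c, d u c = gprod d u v w /\ d c v = gprod d v u w /\
    gprod d w u v <= d c w /\ gprod d c u w <= delta /\ gprod d c v w <= delta.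
Proof.
  destruct (interp u v (gprod d u v w)) as (c & E1 & E2).
  { split; [apply gprod_nonneg | apply gprod_le_l]. }
  exists c.
  assert (E3 : d c v = gprod d v u w) by (pose proof (gprod_split u v w); lra).
  pose proof (metric_tri u c w).
  pose proof (metric_sym u w). pose proof (metric_sym v w). pose proof (metric_sym u v).
  pose proof (metric_sym u c).
  destruct (four_point_dist u c v w) as [A | A];
  rewrite E1 in *; rewrite E3 in *; unfold gprod in *; lra.
Qed.

(** The gain [a] persists: the four-point inequality for [p], [f p], [f (f p)] and the iterate of
    order [n + 2] either yields the next gain or contradicts the previous one. *)
Lemma isometry_linear_growth (f : X -> X) (isom : forall x y, d (f x) (f y) = d x y) p a :
  d p (f p) + 2 * delta + a <= d p (f (f p)) -> 0 < a ->
  forall n, INR n * a <= d p (Nat.iter n f p).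
Proof.
  intros H Ha.
  assert (step : forall n, d p (Nat.iter n f p) + a <= d p (Nat.iter (S n) f p)).
  { induction n as [|n IH].
    - simpl. rewrite metric_refl. pose proof (metric_tri p (f p) (f (f p))).
      rewrite isom in *. lra.
    - assert (E : forall k, d (f p) (Nat.iter (S k) f p) = d p (Nat.iter k f p))
        by (intros; apply isom).
      pose proof (E (S n)) as E1. pose proof (E n) as E2.
      assert (E3 : d (f (f p)) (Nat.iter (S (S n)) f p) = d p (Nat.iter n f p))
        by (simpl; now rewrite !isom).
      pose proof (isom p (f p)).
      destruct (four_point_dist p (f p) (f (f p)) (Nat.iter (S (S n)) f p)); lra. }
  induction n as [|n IH].
  - simpl. rewrite Rmult_0_l. apply metric_nonneg.
  - rewrite S_INR. specialize (step n). lra.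
Qed.

Lemma near_line_dist x1 x2 q q' c :
  gprod d q x1 x2 <= c -> gprod d q' x1 x2 <= c ->
  d q q' <= Rabs (d x1 q - d x1 q') + 2 * c + 2 * delta.
Proof.
  intros H1 H2.
  pose proof (Rle_abs (d x1 q - d x1 q')). pose proof (Rle_abs (- (d x1 q - d x1 q'))).
  rewrite Rabs_Ropp in *.
  destruct (four_point_dist q x1 q' x2) as [A | A]; unfold gprod in *;
  pose proof (metric_sym x1 q); pose proof (metric_sym x1 q'); lra.
Qed.

(** An isometry [f] moving the far ends of a long segment [x1 x2] by at most [A]
    acts near its middle like a translation, up to a multiple of [delta]. *)
Section QuasiAxis.
Context (f : X -> X) (isom : forall x y, d (f x) (f y) = d x y).
Context (x1 x2 p : X) (A : R).
Context (on_line : gprod d p x1 x2 = 0).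
Context (move1 : d x1 (f x1) <= A) (move2 : d x2 (f x2) <= A).
Context (far1 : 4 * A + 100 * delta <= d p x1) (far2 : 4 * A + 100 * delta <= d p x2).

Lemma far_gprod x : 4 * A + 100 * delta <= d p x -> d x (f x) <= A ->
  3 * A + 100 * delta <= gprod d (f p) x (f x).
Proof.
  intros F M. pose proof (metric_tri (f p) x (f x)). pose proof (isom p x).
  unfold gprod. lra.
Qed.

(** [f p] lies exactly between [f x1] and [f x2], and seen from [f p] each far end points like its
    image; replacing the two ends costs one [delta] each. *)
Lemma image_near_line : gprod d (f p) x1 x2 <= 2 * delta.
Proof.
  pose proof (gprod_isometry f isom p x1 x2) as E. rewrite on_line in E.
  pose proof (far_gprod x1 far1 move1). pose proof (far_gprod x2 far2 move2).
  pose proof (metric_nonneg x1 (f x1)).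
  rewrite gprod_sym in H.
  destruct (H4 (f p) (f x1) x1 (f x2)) as [?|?]; [lra|].
  destruct (H4 (f p) x1 x2 (f x2)) as [?|?]; lra.
Qed.

Lemma shift_bound : d p (f p) <= Rabs (d x1 p - d x1 (f p)) + 6 * delta.
Proof.
  pose proof image_near_line.
  pose proof (near_line_dist x1 x2 p (f p) (2 * delta)). lra.
Qed.

Lemma displacement_le : d p (f p) <= A + 6 * delta.
Proof.
  pose proof shift_bound. pose proof (metric_tri x1 (f x1) (f p)).
  pose proof (metric_tri (f x1) x1 (f p)). pose proof (metric_sym x1 (f x1)).
  pose proof (isom x1 p).
  assert (Rabs (d x1 p - d x1 (f p)) <= A) by (apply Rabs_le; lra). lra.
Qed.

End QuasiAxis.

(** By [shift_bound] the displacement exceeds the shift along the line by at most [6 delta], and the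
    shift doubles up to [2 delta]: the total loss is [(2 * 6 + 2) delta]. *)
Lemma displacement_doubling f (isom : forall x y, d (f x) (f y) = d x y) x1 x2 p A :
  gprod d p x1 x2 = 0 -> d x1 (f x1) <= A -> d x2 (f x2) <= A ->
  4 * A + 100 * delta <= d p x1 -> 4 * A + 100 * delta <= d p x2 ->
  2 * d p (f p) - 14 * delta <= d p (f (f p)).
Proof.
  intros O M1 M2 F1 F2.
  pose proof (shift_bound f isom x1 x2 p A O M1 M2 F1 F2) as S.
  pose proof (displacement_le f isom x1 x2 p A O M1 M2 F1 F2) as B.
  pose proof (isom x1 p). pose proof (isom x1 (f p)). pose proof (isom p (f p)).
  pose proof (metric_sym p x1). pose proof (metric_sym x1 (f p)).
  pose proof (metric_sym (f p) (f x1)). pose proof (metric_sym (f (f p)) (f x1)).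
  pose proof (metric_sym (f (f p)) (f p)). pose proof (metric_sym (f (f p)) p).
  pose proof (metric_sym (f p) p).
  pose proof (metric_tri x1 (f x1) (f p)). pose proof (metric_tri x1 (f p) p).
  pose proof (metric_tri x1 (f x1) (f (f p))).
  pose proof (metric_tri (f x1) x1 (f p)). pose proof (metric_tri (f x1) x1 (f (f p))).
  pose proof (metric_tri x1 p (f (f p))). pose proof (metric_tri x1 (f (f p)) p).
  (* The shift of [f p] and that of [p], measured from [x1], differ by at most
     [2 delta]: apply the four-point inequality to [x1, f x1, f p, f (f p)]. *)
  assert (d x1 (f (f p)) + d (f x1) (f p) <= d x1 (f p) + d (f x1) (f (f p)) + 2 * delta).
  { destruct (four_point_dist x1 (f p) (f (f p)) (f x1)); lra. }
  assert (d x1 (f p) + d (f x1) (f (f p)) <= d x1 (f (f p)) + d (f x1) (f p) + 2 * delta).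
  { destruct (four_point_dist x1 (f (f p)) (f p) (f x1)); lra. }
  unfold Rabs in S. destruct (Rcase_abs (d x1 p - d x1 (f p))); lra.
Qed.

(** Here [f] pushes [p] towards [x2]. Seen from [f p], [p] lies towards [x1] while [f y] is
    transversal, so from [p] the points [f y] and [f p] share the direction of [x2], which [y]
    avoids. *)
Lemma transversal_gprod_forward f (isom : forall x y, d (f x) (f y) = d x y) x1 x2 p y A :
  gprod d p x1 x2 = 0 -> d x1 (f x1) <= A -> d x2 (f x2) <= A ->
  4 * A + 100 * delta <= d p x1 -> 4 * A + 100 * delta <= d p x2 ->
  gprod d p y x1 <= delta -> gprod d p y x2 <= delta ->
  10 * delta <= d p (f p) ->
  d p (f p) <= d x1 (f p) - d x1 p + 6 * delta ->
  gprod d p y (f y) <= 3 * delta.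
Proof.
  intros O M1 M2 F1 F2 Y1 Y2 L S.
  pose proof (image_near_line f isom x1 x2 p A O M1 M2 F1 F2) as N.
  pose proof (far_gprod f isom p A x1 F1 M1) as G1.
  assert (0 <= A) by (pose proof (metric_nonneg x1 (f x1)); lra).
  pose proof (gprod_isometry f isom p y x1) as I1.
  assert (P1 : d p (f p) - 3 * delta <= gprod d (f p) p x1).
  { unfold gprod. rewrite (metric_sym p x1), (metric_sym (f p) x1), (metric_sym (f p) p). lra. }
  assert (P2 : d p (f p) - 5 * delta <= gprod d p (f p) x2).
  { unfold gprod in *. rewrite (metric_sym p x1) in *. rewrite (metric_sym (f p) x1) in *. lra. }
  assert (C1 : gprod d (f p) p (f y) <= 3 * delta).
  { destruct (H4 (f p) (f y) x1 (f x1)) as [?|?]; [|lra].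
    destruct (H4 (f p) (f y) p x1) as [?|?]; [|lra].
    rewrite gprod_sym. lra. }
  assert (C2 : gprod d p y (f p) <= 2 * delta).
  { destruct (H4 p y (f p) x2) as [?|?]; lra. }
  pose proof (gprod_split p (f p) (f y)).
  destruct (H4 p y (f y) (f p)) as [?|?]; [lra|].
  rewrite gprod_sym in H1. lra.
Qed.

Lemma transversal_gprod f (isom : forall x y, d (f x) (f y) = d x y) x1 x2 p y A :
  gprod d p x1 x2 = 0 -> d x1 (f x1) <= A -> d x2 (f x2) <= A ->
  4 * A + 100 * delta <= d p x1 -> 4 * A + 100 * delta <= d p x2 ->
  gprod d p y x1 <= delta -> gprod d p y x2 <= delta ->
  10 * delta <= d p (f p) ->
  gprod d p y (f y) <= 3 * delta.
Proof.
  intros O M1 M2 F1 F2 Y1 Y2 L.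
  pose proof (shift_bound f isom x1 x2 p A O M1 M2 F1 F2) as S.
  unfold Rabs in S. destruct (Rcase_abs (d x1 p - d x1 (f p))).
  - apply (transversal_gprod_forward f isom x1 x2 p y A); auto; lra.
  (* [f] pushes [p] towards [x1], so the ends are exchanged; as [p] is on the segment, the shift
     measured from [x2] is at least as large. *)
  - apply (transversal_gprod_forward f isom x2 x1 p y A); auto.
    + now rewrite gprod_sym.
    + unfold gprod in O. pose proof (metric_tri x1 (f p) x2).
      rewrite (metric_sym p x1), (metric_sym p x2) in O.
      rewrite (metric_sym (f p) x2) in H. lra.
Qed.

(** Seen from [f p], the product of [f y] and [f (f y)] is that of [y] and [f y] seen from [p];
    moving the base point back costs [d p (f p)]. *)
Lemma gprod_double f (isom : forall x y, d (f x) (f y) = d x y) p y :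
  gprod d p y (f y) <= gprod d p y (f (f y)) + d p (f p) + delta.
Proof.
  pose proof (gprod_isometry f isom p y (f y)) as I.
  pose proof (gprod_move_base (f p) p (f y) (f (f y))).
  rewrite (metric_sym (f p) p) in *.
  pose proof (metric_nonneg p (f p)).
  destruct (H4 p y (f y) (f (f y))); lra.
Qed.

End HyperbolicMetric.

(** * Fekete's lemma and lists without repetition *)

Lemma fekete (u : nat -> R) :
  (forall n, 0 <= u n) -> (forall m n, u (m + n)%nat <= u m + u n) ->
  exists l, 0 <= l /\ (forall n, INR n * l <= u n) /\
    (forall eps, 0 < eps -> exists N, forall n, (N <= n)%nat -> u n <= INR n * (l + eps)).
Proof.
  intros pos sub.
  assert (mult : forall q m, u (q * m)%nat <= INR q * u m + u 0%nat).
  { induction q as [|q IH]; intros m; [simpl; lra|].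
    rewrite S_INR. simpl. pose proof (sub m (q * m)%nat). specialize (IH m). lra. }
  (* [completeness] provides suprema, hence the sign: [- s] is the infimum of [u n / n] over
     [n >= 1]. *)
  set (E := fun r => exists n, r = - (u (S n) / INR (S n))).
  destruct (completeness E) as [s [ub lub]].
  - exists 0. intros r [n ->]. pose proof (pos (S n)).
    assert (0 <= u (S n) / INR (S n)) by (apply Rle_mult_inv_pos; [easy | apply lt_0_INR; lia]).
    lra.
  - exists (- (u 1%nat / INR 1)). now exists 0%nat.
  - exists (- s). split; [|split].
    + enough (s <= 0) by lra. apply lub. intros r [n ->].
      assert (0 <= u (S n) / INR (S n)) by (apply Rle_mult_inv_pos; [easy | apply lt_0_INR; lia]).
      lra.
    + intros [|n]; [simpl; specialize (pos 0%nat); lra|].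
      assert (0 < INR (S n)) by (apply lt_0_INR; lia).
      assert (H1 : - (u (S n) / INR (S n)) <= s) by (apply ub; now exists n).
      replace (u (S n)) with (INR (S n) * (u (S n) / INR (S n))) by (field; lra).
      apply Rmult_le_compat_l; lra.
    + intros eps Heps.
      assert (Hm : exists m, u (S m) / INR (S m) < - s + eps / 2).
      { apply NNPP. intros no. assert (s <= s - eps / 2); [|lra].
        apply lub. intros r [n ->].
        destruct (Rlt_or_le (u (S n) / INR (S n)) (- s + eps / 2)); [|lra].
        exfalso. apply no. now exists n. }
      destruct Hm as [m Hm]. set (k := S m) in *.
      assert (kpos : 0 < INR k) by (apply lt_0_INR; lia).
      (* [C] bounds the error of dividing [n] by [k] with remainder; each use of [mult] contributes
         one [u 0]. *)
      set (C := INR k * u 1%nat + 2 * u 0%nat).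
      destruct (INR_archimed (eps / 2) C) as [N HN]; [lra|].
      exists N. intros n Hn.
      pose proof (Nat.div_mod_eq n k) as dm.
      pose proof (Nat.mod_upper_bound n k ltac:(lia)) as rlt.
      set (q := (n / k)%nat) in *. set (r := (n mod k)%nat) in *.
      pose proof (sub (k * q)%nat r). pose proof (mult q k) as M1.
      pose proof (mult r 1%nat) as M2. rewrite Nat.mul_1_r in M2. rewrite Nat.mul_comm in M1.
      assert (INR r * u 1%nat <= INR k * u 1%nat).
      { apply Rmult_le_compat_r; [apply pos | apply le_INR; lia]. }
      assert (u k <= INR k * (- s + eps / 2)).
      { replace (u k) with (INR k * (u k / INR k)) by (field; lra).
        apply Rmult_le_compat_l; lra. }
      assert (Hq : INR q * u k <= INR q * (INR k * (- s + eps / 2))).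
      { apply Rmult_le_compat_l; [apply pos_INR | easy]. }
      assert (En : INR n = INR k * INR q + INR r) by (rewrite dm at 1; now rewrite plus_INR, mult_INR).
      assert (INR N * (eps / 2) <= INR n * (eps / 2)).
      { apply Rmult_le_compat_r; [lra | now apply le_INR]. }
      assert (0 <= INR r * (- s + eps / 2)).
      { apply Rmult_le_pos; [apply pos_INR|].
        assert (s <= 0); [|lra]. apply lub. intros r0 [n0 ->].
        assert (0 <= u (S n0) / INR (S n0)) by (apply Rle_mult_inv_pos; [easy | apply lt_0_INR; lia]).
        lra. }
      assert (u n <= u (k * q)%nat + u r) by (rewrite dm at 1; easy).
      assert (INR q * (INR k * (- s + eps / 2)) + INR r * (- s + eps / 2) = INR n * (- s + eps / 2))
        by (rewrite En; ring).
      unfold C in HN. lra.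
Qed.

Lemma NoDup_flat_map {A B} (f : A -> list B) (l : list A) :
  NoDup l -> (forall a, In a l -> NoDup (f a)) ->
  (forall a a' b, In a l -> In a' l -> In b (f a) -> In b (f a') -> a = a') ->
  NoDup (flat_map f l).
Proof.
  induction l as [|a l IH]; intros nd nds disj; simpl; [constructor|].
  inversion nd as [|? ? notin nd']; subst. apply NoDup_app.
  - apply nds. now left.
  - apply IH; auto using in_cons. intros. eapply disj; eauto using in_cons.
  - intros b Hb Hb'. apply in_flat_map in Hb' as (a' & Ha' & Hb').
    apply notin. replace a with a'; [easy|]. symmetry.
    eapply disj; eauto using in_cons. now left.
Qed.

Lemma NoDup_map_in {A B} (f : A -> B) (l : list A) :
  NoDup l -> (forall a a', In a l -> In a' l -> f a = f a' -> a = a') -> NoDup (map f l).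
Proof. intros nd inj. apply NoDup_map_NoDup_ForallPairs; [|easy]. intros a b Ha Hb. now apply inj. Qed.

(** * Isometric group actions: powers, orbits and free semigroups *)

Section Action.
Context {G : Type} {mul : G -> G -> G} {inv : G -> G} {e : G}.
Context (group : is_group mul inv e).

Lemma mul_assoc a b c : mul a (mul b c) = mul (mul a b) c.
Proof. apply group. Qed.
Lemma mul_e_l a : mul e a = a.
Proof. apply group. Qed.
Lemma mul_e_r a : mul a e = a.
Proof. apply group. Qed.
Lemma mul_inv_l a : mul (inv a) a = e.
Proof. apply group. Qed.

Lemma mul_cancel_l a b c : mul a b = mul a c -> b = c.
Proof.
  intros H. rewrite <- (mul_e_l b), <- (mul_e_l c), <- (mul_inv_l a), <- !mul_assoc.
  now rewrite H.
Qed.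

Lemma mul_cancel_r a b c : mul b a = mul c a -> b = c.
Proof.
  intros H. assert (I : mul a (inv a) = e) by apply group.
  now rewrite <- (mul_e_r b), <- (mul_e_r c), <- I, !mul_assoc, H.
Qed.

Local Notation pow := (gpow mul e).

Lemma gpow_add g m n : pow g (m + n) = mul (pow g m) (pow g n).
Proof.
  induction m as [|m IH]; simpl; [now rewrite mul_e_l | now rewrite IH, mul_assoc].
Qed.

Lemma gpow_injective g m n : ~ finite_order mul e g -> pow g m = pow g n -> m = n.
Proof.
  assert (aux : forall m n, ~ finite_order mul e g -> (m <= n)%nat -> pow g m = pow g n -> m = n).
  { clear m n. intros m n inf le E. destruct (Nat.eq_dec m n) as [|ne]; [easy|].
    exfalso. apply inf. exists (n - m)%nat. split; [lia|].
    replace n with (m + (n - m))%nat in E by lia. rewrite gpow_add in E.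
    rewrite <- (mul_e_r (pow g m)) in E at 1. symmetry. now apply mul_cancel_l in E. }
  intros inf E. destruct (Nat.le_ge_cases m n); [|symmetry]; now apply aux.
Qed.

Context {X : Type} {d : X -> X -> R} {act : G -> X -> X}.
Context (metric : is_metric d) (iso : isometric_action mul e d act).

Lemma act_e x : act e x = x.
Proof. apply iso. Qed.
Lemma act_mul g h x : act (mul g h) x = act g (act h x).
Proof. apply iso. Qed.
Lemma act_dist g x y : d (act g x) (act g y) = d x y.
Proof. apply iso. Qed.

Lemma act_inv_dist g x y : d (act (inv g) x) y = d x (act g y).
Proof.
  rewrite <- (act_dist g), <- act_mul.
  replace (mul g (inv g)) with e by (symmetry; apply group). now rewrite act_e.
Qed.

Lemma act_gpow_iter g k n x : act (pow g (n * k)) x = Nat.iter n (act (pow g k)) x.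
Proof.
  induction n as [|n IH]; [apply act_e|].
  replace (S n * k)%nat with (k + n * k)%nat by lia.
  rewrite gpow_add, act_mul. simpl. now rewrite IH.
Qed.

Lemma act_gpow_subadditive g x m n :
  d x (act (pow g (m + n)) x) <= d x (act (pow g m) x) + d x (act (pow g n) x).
Proof.
  rewrite gpow_add, act_mul.
  pose proof (metric_tri metric x (act (pow g m) x) (act (pow g m) (act (pow g n) x))).
  now rewrite act_dist in H.
Qed.

Lemma act_gpow_le g x n : d x (act (pow g n) x) <= INR n * d x (act g x).
Proof.
  induction n as [|n IH].
  - simpl. rewrite act_e, (metric_refl metric). lra.
  - rewrite S_INR. pose proof (act_gpow_subadditive g x 1 n) as H.
    simpl in H. rewrite mul_e_r in H. simpl. lra.
Qed.

Lemma displacement_move_base g x p : d p (act g p) <= d x (act g x) + 2 * d x p.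
Proof.
  pose proof (metric_tri metric p x (act g p)). pose proof (metric_tri metric x (act g x) (act g p)).
  rewrite act_dist in *. rewrite (metric_sym metric p x) in *. lra.
Qed.

(** Otherwise all powers of [g], which are pairwise distinct, would lie in the finite list given by
    properness. *)
Lemma infinite_order_unbounded g x Q : proper_action d act -> ~ finite_order mul e g ->
  exists n, Q <= d x (act (pow g n) x).
Proof.
  intros prop inf. destruct (prop x Q) as [l Hl].
  apply NNPP. intros no.
  assert (len : (length (map (pow g) (seq 0 (S (length l)))) <= length l)%nat).
  { apply NoDup_incl_length.
    - apply NoDup_map_in; [apply seq_NoDup|]. intros m n _ _. now apply gpow_injective.
    - intros h Hh. apply in_map_iff in Hh as (n & <- & _). apply Hl.
      destruct (Rle_or_lt (d x (act (pow g n) x)) Q); [easy|].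
      exfalso. apply no. exists n. lra. }
  rewrite length_map, length_seq in len. lia.
Qed.

(** * Ping-pong and entropy *)

(** Products are listed with multiplicity, so freeness of the semigroup is expressed by
    [NoDup (words S n)]. *)
Fixpoint words (S : list G) (n : nat) : list G :=
  match n with
  | O => e :: nil
  | Datatypes.S n => flat_map (fun s => map (mul s) (words S n)) S
  end.

Lemma length_words S n : length (words S n) = (length S ^ n)%nat.
Proof.
  induction n as [|n IH]; simpl; [easy|].
  rewrite (flat_map_constant_length (c := (length S ^ n)%nat)); [easy|].
  intros. now rewrite length_map.
Qed.

Lemma words_displacement S p lam : (forall s, In s S -> d p (act s p) <= lam) ->
  forall n w, In w (words S n) -> d p (act w p) <= INR n * lam.
Proof.
  intros H. induction n as [|n IH]; intros w Hw.
  - destruct Hw as [<- | []]. rewrite act_e, (metric_refl metric). simpl. lra.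
  - simpl in Hw. apply in_flat_map in Hw as (s & Hs & Hw).
    apply in_map_iff in Hw as (w' & <- & Hw').
    rewrite act_mul, S_INR. specialize (H s Hs). specialize (IH w' Hw').
    pose proof (metric_tri metric p (act s p) (act s (act w' p))). rewrite act_dist in *. lra.
Qed.

Section FreeSemigroup.
Context {delta : R} (delta_pos : 0 < delta) (H4 : four_point (d := d) (delta := delta)).
Context (S : list G) (p : X) (b : R) (b_pos : 0 <= b).
Context (long : forall s, In s S -> 2 * b + 4 * delta <= d p (act s p)).
Context (apart : forall s s', In s S -> In s' S -> s <> s' ->
  gprod d p (act s p) (act s' p) <= b).
Context (straight : forall s s', In s S -> In s' S ->
  gprod d p (act (inv s) p) (act s' p) <= b).

(** Seen from [p], a word points like its first letter: by [gprod_split] the product is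
    [d p (act s p)] minus [(s^-1 p | w p)_p], at least [(2b + 4 delta) - (b + delta)]. *)
Lemma first_letter_gprod s w : In s S ->
  gprod d p (act (inv s) p) (act w p) <= b + delta ->
  b + 3 * delta <= gprod d p (act s p) (act (mul s w) p).
Proof.
  intros Hs Hw. specialize (long s Hs).
  pose proof (gprod_split metric p (act s p) (act (mul s w) p)) as E.
  rewrite act_mul in *.
  assert (gprod d (act s p) p (act s (act w p)) = gprod d p (act (inv s) p) (act w p)).
  { unfold gprod. rewrite !act_dist, act_inv_dist.
    rewrite (metric_sym metric p (act (inv s) p)), act_inv_dist, (metric_sym metric (act s p) p).
    easy. }
  lra.
Qed.

(** Induction on the word: it points like its first letter, a direction that [s^-1 p] avoids by
    [straight]. *)
Lemma words_straight n : forall w s, In w (words S n) -> In s S ->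
  gprod d p (act (inv s) p) (act w p) <= b + delta.
Proof.
  induction n as [|n IH]; intros w s Hw Hs.
  - destruct Hw as [<- | []]. rewrite act_e.
    pose proof (gprod_le_r metric p (act (inv s) p) p). rewrite (metric_refl metric) in *. lra.
  - simpl in Hw. apply in_flat_map in Hw as (s' & Hs' & Hw).
    apply in_map_iff in Hw as (w' & <- & Hw').
    pose proof (first_letter_gprod s' w' Hs' (IH _ _ Hw' Hs')).
    specialize (straight s s' Hs Hs').
    rewrite (gprod_sym metric p (act s' p)) in *.
    destruct (H4 p (act (inv s) p) (act (mul s' w') p) (act s' p)); lra.
Qed.

(** Equal first letters cancel; for distinct ones a common value [w p] would point in two directions
    separated by [apart]. *)
Lemma NoDup_words n : NoDup S -> NoDup (words S n).
Proof.
  intros nd. induction n as [|n IH]; simpl; [repeat constructor; easy|].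
  apply NoDup_flat_map; [easy | |].
  - intros s _. apply NoDup_map_in; [easy|]. intros ? ? _ _. apply mul_cancel_l.
  - intros s s' w Hs Hs' Hw Hw'. apply NNPP. intros ne.
    apply in_map_iff in Hw as (v & E & Hv). apply in_map_iff in Hw' as (v' & E' & Hv').
    pose proof (first_letter_gprod s v Hs (words_straight n _ _ Hv Hs)) as A1.
    pose proof (first_letter_gprod s' v' Hs' (words_straight n _ _ Hv' Hs')) as A2.
    rewrite E in A1. rewrite E', gprod_sym in A2 by easy.
    specialize (apart s s' Hs Hs' ne).
    destruct (H4 p (act s p) (act w p) (act s' p)); lra.
Qed.

End FreeSemigroup.

Lemma entropy_gt_of_words S p lam c :
  (forall n, NoDup (words S n)) -> (forall s, In s S -> d p (act s p) <= lam) ->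
  (1 <= length S)%nat -> 0 < lam -> 0 <= c -> c * lam < ln (INR (length S)) ->
  forall x, entropy_gt d act x c.
Proof.
  intros nd disp len lam_pos c_pos Hc x.
  set (L := ln (INR (length S))) in *.
  set (r := d x p). pose proof (metric_nonneg metric x p : 0 <= r).
  assert (Hgap : 0 < L / lam - c).
  { enough (c < L / lam) by lra. apply Rmult_lt_reg_r with lam; [easy|].
    replace (L / lam * lam) with L by (field; lra). easy. }
  set (gap := L / lam - c) in *.
  assert (EL : L = (c + gap) * lam) by (unfold gap; field; lra).
  assert (L_pos : 0 < L) by (rewrite EL; apply Rmult_lt_0_compat; lra).
  (* Half of [gap] pays, for large radii, for the change of base point ([2 * r]) and for rounding
     the radius to a multiple of [lam]. *)
  set (R0 := 2 * r + lam + 2 * ((2 * r / lam + 2) * L) / gap).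
  exists (c + gap / 2), R0. split; [lra|].
  assert (T0 : 0 < (2 * r / lam + 2) * L).
  { apply Rmult_lt_0_compat; [|easy].
    assert (0 <= 2 * r / lam) by (apply Rle_mult_inv_pos; lra). lra. }
  assert (T1 : 0 < 2 * ((2 * r / lam + 2) * L) / gap).
  { unfold Rdiv. apply Rmult_lt_0_compat; [lra | now apply Rinv_0_lt_compat]. }
  intros R N HR (l & ndl & lenl & Hl).
  assert (Hn : exists n, INR n * lam + 2 * r < R /\ R <= (INR n + 2) * lam + 2 * r).
  { destruct (archimed ((R - 2 * r) / lam)) as [U1 U2].
    set (z := up ((R - 2 * r) / lam)) in *.
    assert (V : 1 <= (R - 2 * r) / lam).
    { apply Rmult_le_reg_r with lam; [easy|].
      replace ((R - 2 * r) / lam * lam) with (R - 2 * r) by (field; lra). unfold R0 in HR. lra. }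
    assert (Hz : (2 <= z)%Z). { assert (1 < z)%Z; [apply lt_IZR; lra | lia]. }
    (* [up] may exceed its argument by a full unit; subtracting 2 gives the strict inequality
       required by the open balls of [orbit_count]. *)
    exists (Z.to_nat (z - 2)). rewrite INR_IZR_INZ, Z2Nat.id, minus_IZR by lia.
    assert (E : R - 2 * r = (R - 2 * r) / lam * lam) by (field; lra).
    split.
    - assert ((IZR z - 2) * lam < (R - 2 * r) / lam * lam); [|lra].
      apply Rmult_lt_compat_r; lra.
    - assert ((R - 2 * r) / lam * lam <= (IZR z - 2 + 2) * lam); [|lra].
      apply Rmult_le_compat_r; lra. }
  destruct Hn as (n & Hn1 & Hn2).
  assert (HN : (length S ^ n <= N)%nat).
  { rewrite <- length_words, <- lenl. apply NoDup_incl_length; [apply nd|].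
    intros w Hw. apply Hl. pose proof (words_displacement S p lam disp n w Hw).
    pose proof (displacement_move_base w p x) as M. rewrite (metric_sym metric p x) in M.
    fold r in M. lra. }
  apply le_INR in HN. rewrite pow_INR in HN.
  assert (Spos : 0 < INR (length S)) by (apply lt_0_INR; lia).
  assert (HL : INR n * L <= ln (INR N)).
  { unfold L. rewrite <- ln_pow by easy. destruct HN as [HN | <-]; [|lra].
    left. apply ln_increasing; [now apply pow_lt | easy]. }
  assert (Rpos : 0 < R) by (unfold R0 in HR; lra).
  apply Rmult_le_reg_r with R; [easy|].
  replace (ln (INR N) / R * R) with (ln (INR N)) by (field; lra).
  assert (K1 : (R - 2 * r) * L <= (INR n + 2) * lam * L) by (apply Rmult_le_compat_r; lra).
  assert (K2 : R * (c + gap) - 2 * r / lam * L - 2 * L <= INR n * L).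
  { apply Rmult_le_reg_r with lam; [easy|].
    replace ((R * (c + gap) - 2 * r / lam * L - 2 * L) * lam)
      with (R * ((c + gap) * lam) - 2 * r * L - 2 * L * lam) by (field; lra).
    rewrite <- EL. lra. }
  assert (K3 : 2 * ((2 * r / lam + 2) * L) / gap * (gap / 2) <= R * (gap / 2)).
  { apply Rmult_le_compat_r; [lra|]. unfold R0 in HR. lra. }
  replace (2 * ((2 * r / lam + 2) * L) / gap * (gap / 2)) with ((2 * r / lam + 2) * L) in K3
    by (field; lra).
  lra.
Qed.

End Action.

(** * Points at infinity, tripods and segments leaving a geodesic transversally *)

Section Transversal.
Context {X : Type} {d : X -> X -> R} {delta : R}.
Context (metric : is_metric d) (delta_pos : 0 < delta).
Context (H4 : four_point (d := d) (delta := delta)) (interp : interpolating (d := d)).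

(** Non-equivalence only gives some late pairs with a small product; since [u] and [v] converge, two
    four-point steps carry this bound to all late indices. *)
Lemma not_equiv_gprod_bounded o u v :
  conv_at_infinity d o u -> conv_at_infinity d o v -> ~ equiv_at_infinity d o u v ->
  exists K N, forall n, (N <= n)%nat -> gprod d o (u n) (v n) <= K.
Proof.
  intros Hu Hv Hn. apply not_all_ex_not in Hn as [K Hn].
  destruct (Hu (K + 3 * delta)) as [N1 HN1], (Hv (K + 3 * delta)) as [N2 HN2].
  exists (K + 2 * delta), (N1 + N2)%nat. intros n Hle.
  assert (E : exists i j, (N1 + N2 <= i)%nat /\ (N1 + N2 <= j)%nat /\ gprod d o (u i) (v j) < K).
  { apply NNPP. intros no. apply Hn. exists (N1 + N2)%nat. intros i j Hi Hj.
    destruct (Rle_or_lt K (gprod d o (u i) (v j))); [easy|].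
    exfalso. apply no. now exists i, j. }
  destruct E as (i & j & Hi & Hj & Hij).
  specialize (HN1 i n ltac:(lia) ltac:(lia)). specialize (HN2 n j ltac:(lia) ltac:(lia)).
  destruct (H4 o (u i) (u n) (v j)); [lra|].
  destruct (H4 o (u n) (v n) (v j)); lra.
Qed.

Lemma non_elementary_tripod : non_elementary d -> forall r, exists c y1 y2 y3,
  r <= d c y1 /\ r <= d c y2 /\ r <= d c y3 /\
  gprod d c y1 y2 <= delta /\ gprod d c y2 y3 <= delta /\ gprod d c y1 y3 <= delta.
Proof.
  intros (o & u & v & w & Hu & Hv & Hw & Huv & Hvw & Huw) r.
  destruct (not_equiv_gprod_bounded o u v Hu Hv Huv) as (K1 & N1 & B1).
  destruct (not_equiv_gprod_bounded o v w Hv Hw Hvw) as (K2 & N2 & B2).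
  destruct (not_equiv_gprod_bounded o u w Hu Hw Huw) as (K3 & N3 & B3).
  set (K := Rmax K1 (Rmax K2 K3)).
  assert (K1 <= K /\ K2 <= K /\ K3 <= K) as (? & ? & ?).
  { unfold K. pose proof (Rmax_l K1 (Rmax K2 K3)). pose proof (Rmax_r K1 (Rmax K2 K3)).
    pose proof (Rmax_l K2 K3). pose proof (Rmax_r K2 K3). lra. }
  (* With products at [o] at most [K], the leg from the centre to [u n] has length at least
     [d o (u n) - 2 * K], and likewise for the others. *)
  destruct (Hu (r + 2 * K)) as [M1 F1], (Hv (r + 2 * K)) as [M2 F2], (Hw (r + 2 * K)) as [M3 F3].
  set (n := (N1 + N2 + N3 + M1 + M2 + M3)%nat).
  specialize (B1 n ltac:(lia)). specialize (B2 n ltac:(lia)). specialize (B3 n ltac:(lia)).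
  specialize (F1 n n ltac:(lia) ltac:(lia)). specialize (F2 n n ltac:(lia) ltac:(lia)).
  specialize (F3 n n ltac:(lia) ltac:(lia)).
  pose proof (gprod_le_l metric o (u n) (u n)). pose proof (gprod_le_l metric o (v n) (v n)).
  pose proof (gprod_le_l metric o (w n) (w n)).
  destruct (tripod_center metric H4 interp (u n) (v n) (w n)) as (c & E1 & E2 & E3 & E4 & E5).
  exists c, (u n), (v n), (w n).
  pose proof (metric_tri metric (u n) o (v n)). pose proof (metric_tri metric (v n) o (w n)).
  pose proof (metric_tri metric (u n) o (w n)).
  pose proof (metric_sym metric o (u n)). pose proof (metric_sym metric o (v n)).
  pose proof (metric_sym metric o (w n)). pose proof (metric_sym metric c (u n)).
  pose proof (metric_sym metric (u n) (v n)). pose proof (metric_sym metric (v n) (w n)).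
  pose proof (metric_sym metric (u n) (w n)).
  pose proof (gprod_split metric (u n) (v n) (w n)).
  assert (gprod d c (u n) (v n) = 0) by (unfold gprod in *; lra).
  unfold gprod in *. repeat split; lra.
Qed.

(** Each of [x1], [x2] can point along at most one of three pairwise divergent legs. *)
Lemma tripod_transversal_leg c y1 y2 y3 x1 x2 :
  gprod d c y1 y2 <= delta -> gprod d c y2 y3 <= delta -> gprod d c y1 y3 <= delta ->
  exists y, (y = y1 \/ y = y2 \/ y = y3) /\
    gprod d c y x1 <= 2 * delta /\ gprod d c y x2 <= 2 * delta.
Proof.
  intros A12 A23 A13.
  assert (pair : forall y y' x, gprod d c y y' <= delta ->
    gprod d c y x <= 2 * delta \/ gprod d c y' x <= 2 * delta).
  { intros y y' x A. rewrite (gprod_sym metric c y' x). destruct (H4 c y x y'); [left | right]; lra. }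
  destruct (pair _ _ x1 A12), (pair _ _ x1 A23), (pair _ _ x1 A13),
    (pair _ _ x2 A12), (pair _ _ x2 A23), (pair _ _ x2 A13);
  solve [exists y1; tauto | exists y2; tauto | exists y3; tauto].
Qed.

(** [p] is the tripod centre of [x1], [x2], [y], a foot of [y] on the segment, and [y'] cuts the leg
    from [p] to [y] at length [a]; that leg is at least [d c y - 4 * delta] long. *)
Lemma transversal_projection x1 x2 c y a r :
  gprod d c x1 x2 <= r -> gprod d c y x1 <= 2 * delta -> gprod d c y x2 <= 2 * delta ->
  0 <= a -> a + 4 * delta <= d c y ->
  exists p y', d p y' = a /\ gprod d p x1 x2 = 0 /\
    gprod d p y' x1 <= delta /\ gprod d p y' x2 <= delta /\
    d c x1 - r - 2 * delta <= d p x1 /\ d c x2 - r - 2 * delta <= d p x2.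
Proof.
  intros Hr H1 H2 Ha Hy.
  destruct (tripod_center metric H4 interp x1 x2 y) as (p & E1 & E2 & E3 & E4 & E5).
  pose proof (gprod_split metric x1 x2 y).
  pose proof (metric_sym metric x1 x2). pose proof (metric_sym metric y x1).
  pose proof (metric_sym metric y x2). pose proof (metric_sym metric p x1).
  pose proof (metric_tri metric x1 c y). pose proof (metric_tri metric x2 c y).
  pose proof (metric_sym metric c x1). pose proof (metric_sym metric c x2).
  pose proof (metric_tri metric x1 c x2).
  assert (Hpy : a <= d p y) by (unfold gprod in *; lra).
  destruct (interp p y a) as (y' & F1 & F2); [lra|].
  pose proof (metric_tri metric y y' x1). pose proof (metric_tri metric y y' x2).
  pose proof (metric_sym metric y y').
  exists p, y'. unfold gprod in *. repeat split; lra.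
Qed.

End Transversal.

(** * Powers of an element with small translation length *)

Section SmallTranslation.
Context {X : Type} {d : X -> X -> R} {delta : R}.
Context (metric : is_metric d) (delta_pos : 0 < delta).
Context (H4 : four_point (d := d) (delta := delta)) (interp : interpolating (d := d)).
Context {G : Type} {mul : G -> G -> G} {inv : G -> G} {e : G} {act : G -> X -> X}.
Context (group : is_group mul inv e) (iso : isometric_action mul e d act).
Context (prop : proper_action d act).
Context {D : R} (cocompact : forall x y, exists h, d x (act h y) <= D).
Context {g : G} (infinite : ~ finite_order mul e g).
Context {x : X} {l : R} (l_nonneg : 0 <= l).

Local Notation pow := (gpow mul e).

Context (l_lower : forall n, INR n * l <= d x (act (pow g n) x)).
Context (l_upper : forall eps, 0 < eps -> exists N, forall n, (N <= n)%nat ->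
  d x (act (pow g n) x) <= INR n * (l + eps)).

(** A smaller displacement at [p] would accumulate under iteration and beat [l_lower], the base
    point change costing only [2 * d x p]. *)
Lemma power_displacement_ge k p : INR k * l <= d p (act (pow g k) p).
Proof.
  destruct (Rle_or_lt (INR k * l) (d p (act (pow g k) p))) as [|H]; [easy|]. exfalso.
  destruct (INR_archimed (INR k * l - d p (act (pow g k) p)) (2 * d x p)) as [n Hn]; [lra|].
  pose proof (l_lower (n * k)) as L. rewrite mult_INR in L.
  pose proof (displacement_move_base metric iso (pow g (n * k)) p x) as M.
  rewrite (metric_sym metric p x) in M.
  assert (P : d p (act (pow g (n * k)) p) <= INR n * d p (act (pow g k) p)).
  { clear - metric iso group. induction n as [|n IH].
    - simpl. rewrite (act_e iso), (metric_refl metric). lra.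
    - rewrite S_INR. replace (S n * k)%nat with (n * k + k)%nat by lia.
      pose proof (act_gpow_subadditive group metric iso g p (n * k) k). lra. }
  lra.
Qed.

(** Both ends move equally because [g^k] commutes with [g^n]; the bound is uniform in [k <= m] and
    independent of [n]. *)
Lemma ends_move n k m : (k <= m)%nat ->
  d x (act (pow g k) x) <= INR m * d x (act g x) /\
  d (act (pow g n) x) (act (pow g k) (act (pow g n) x)) <= INR m * d x (act g x).
Proof.
  intros le.
  assert (B : d x (act (pow g k) x) <= INR m * d x (act g x)).
  { apply Rle_trans with (INR k * d x (act g x)).
    - apply (act_gpow_le group metric iso).
    - apply Rmult_le_compat_r; [apply (metric_nonneg metric) | now apply le_INR]. }
  split; [easy|].
  rewrite <- (act_mul iso), <- (gpow_add group), Nat.add_comm, (gpow_add group),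
    (act_mul iso), (act_dist iso). easy.
Qed.

(** The [16 delta] is the [14 delta] of doubling plus the [2 delta] of linear growth: a larger
    displacement would make the iterates of [g^k] grow faster than rate [k l], against [l_upper]. *)
Lemma power_displacement_le n m p k : (k <= m)%nat ->
  gprod d p x (act (pow g n) x) = 0 ->
  4 * (INR m * d x (act g x)) + 100 * delta <= d p x ->
  4 * (INR m * d x (act g x)) + 100 * delta <= d p (act (pow g n) x) ->
  d p (act (pow g k) p) <= INR k * l + 16 * delta.
Proof.
  intros le O F1 F2. destruct (ends_move n k m le) as [M1 M2].
  set (f := act (pow g k)) in *.
  assert (isom : forall y z, d (f y) (f z) = d y z) by (intros; apply (act_dist iso)).
  pose proof (displacement_doubling metric delta_pos H4 f isom x (act (pow g n) x) p _ O M1 M2 F1 F2)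
    as Hdouble.
  destruct (Rle_or_lt (d p (f p)) (INR k * l + 16 * delta)) as [|H]; [easy|]. exfalso.
  assert (kl : 0 <= INR k * l) by (apply Rmult_le_pos; [apply pos_INR | easy]).
  assert (kpos : 0 < INR k).
  { apply lt_0_INR. destruct k; [|lia]. exfalso. unfold f in H. simpl in H.
    rewrite (act_e iso), (metric_refl metric) in H. lra. }
  set (a := d p (f p) - 16 * delta) in *.
  pose proof (isometry_linear_growth metric delta_pos H4 f isom p a) as growth.
  assert (Ha : 0 < a) by (unfold a; lra).
  specialize (growth ltac:(unfold a; lra) Ha).
  set (gap := a - INR k * l). assert (Hgap : 0 < gap) by (unfold gap, a; lra).
  destruct (l_upper (gap / (2 * INR k))) as [N HN].
  { apply Rdiv_lt_0_compat; lra. }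
  destruct (INR_archimed (gap / 2) (2 * d x p)) as [N' HN']; [lra|].
  set (i := (N + N')%nat).
  assert (Hi : (N <= i * k)%nat).
  { destruct k as [|k']; [simpl in kpos; lra|]. unfold i. nia. }
  specialize (HN _ Hi). specialize (growth i).
  unfold f in growth. rewrite <- (act_gpow_iter group iso) in growth.
  pose proof (displacement_move_base metric iso (pow g (i * k)) x p) as M.
  rewrite mult_INR in HN.
  replace (INR i * INR k * (l + gap / (2 * INR k))) with (INR i * (INR k * l + gap / 2)) in HN
    by (field; lra).
  assert (INR N' * (gap / 2) <= INR i * (gap / 2)).
  { apply Rmult_le_compat_r; [lra|]. apply le_INR. unfold i. lia. }
  assert (INR i * a = INR i * (INR k * l + gap)) by (unfold gap; ring).
  lra.
Qed.

Lemma long_axis Q : exists n p, gprod d p x (act (pow g n) x) = 0 /\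
  Q <= d p x /\ Q <= d p (act (pow g n) x).
Proof.
  destruct (infinite_order_unbounded group g x (2 * Q) prop infinite) as [n Hn].
  exists n. destruct (interp x (act (pow g n) x) (d x (act (pow g n) x) / 2)) as (p & E1 & E2).
  { pose proof (metric_nonneg metric x (act (pow g n) x)). lra. }
  exists p. pose proof (metric_sym metric x p). unfold gprod. lra.
Qed.

(** If [l = 0], arbitrarily many powers of [g] move some point, hence after
    conjugation the fixed point [x], by a bounded amount. *)
Lemma translation_length_pos : 0 < l.
Proof.
  destruct l_nonneg as [|E]; [easy|]. exfalso.
  (* Displacement [16 delta] at [p] when [l = 0], plus [2 * D] for a base point within [D] of
     [p]. *)
  destruct (prop x (2 * D + 16 * delta)) as [L HL].
  set (m := length L).
  destruct (long_axis (4 * (INR m * d x (act g x)) + 100 * delta)) as (n & p & O & F1 & F2).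
  destruct (cocompact x p) as [h Hh].
  assert (len : (length (map (fun k => mul h (mul (pow g k) (inv h))) (seq 0 (S m))) <= m)%nat).
  { apply NoDup_incl_length.
    - apply NoDup_map_in; [apply seq_NoDup|]. intros i j _ _ Eij.
      apply (gpow_injective group g); [easy|].
      now apply (mul_cancel_l group), (mul_cancel_r group) in Eij.
    - intros s Hs. apply in_map_iff in Hs as (k & <- & Hk). apply in_seq in Hk.
      pose proof (power_displacement_le n m p k ltac:(lia) O F1 F2) as Hd.
      rewrite <- E, Rmult_0_r in Hd.
      apply HL. rewrite !(act_mul iso).
      set (z := act (inv h) x).
      assert (Ez : d z p <= D).
      { unfold z. now rewrite (act_inv_dist group iso). }
      assert (Ex : d x (act h (act (pow g k) z)) = d z (act (pow g k) z))
        by (unfold z at 2; now rewrite (act_inv_dist group iso)).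
      rewrite Ex.
      pose proof (displacement_move_base metric iso (pow g k) p z).
      rewrite (metric_sym metric p z) in *. lra. }
  rewrite length_map, length_seq in len. lia.
Qed.

Section Scale.
Context {I : nat} (large : 10 * delta <= INR (2 ^ I) * l).
Context (small : forall k, (k < 2 ^ I)%nat -> INR k * l <= 20 * delta).

(** A tripod centre is translated to within [D] of a point [p0] deep inside a long segment; one leg
    avoids both ends, and its foot on the segment is [p]. *)
Lemma transversal_axis (elem : non_elementary d) a : 0 <= a ->
  exists p y, d p y = a /\
    (forall k, (k < 2 ^ I)%nat -> d p (act (pow g k) p) <= 36 * delta) /\
    (forall k, (1 <= k < 2 ^ I)%nat ->
       gprod d p y (act (pow g k) y) <= (3 + 37 * INR I) * delta).
Proof.
  (* Doubling an exponent below [2 ^ I] can reach up to [2 ^ (I + 1)], so the segment must be long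
     enough for all these powers. *)
  intros Ha. set (m := (2 * 2 ^ I)%nat). set (A := INR m * d x (act g x)).
  assert (D_nonneg : 0 <= D).
  { destruct (cocompact x x) as [h Hh]. pose proof (metric_nonneg metric x (act h x)). lra. }
  destruct (non_elementary_tripod metric delta_pos H4 interp elem (a + 4 * delta))
    as (c0 & y1 & y2 & y3 & R1 & R2 & R3 & A12 & A23 & A13).
  (* The extra [2 * D + 2 * delta] is lost in passing from [p0] to [c] and then to the foot [p]. *)
  destruct (long_axis (4 * A + 100 * delta + 2 * D + 2 * delta)) as (n & p0 & O & F1 & F2).
  set (x2 := act (pow g n) x) in *.
  destruct (cocompact p0 c0) as [h Hh].
  pose proof (fun y z => gprod_isometry (act h) (act_dist iso h) c0 y z) as Ih.
  destruct (tripod_transversal_leg metric H4 (act h c0) (act h y1) (act h y2) (act h y3) x x2)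
    as (y0 & Hy0 & T1 & T2); [now rewrite Ih..|].
  assert (R0 : a + 4 * delta <= d (act h c0) y0).
  { destruct Hy0 as [-> | [-> | ->]]; now rewrite (act_dist iso). }
  set (c := act h c0) in *.
  pose proof (gprod_move_base metric c p0 x x2) as Hc. rewrite (metric_sym metric c p0) in Hc.
  destruct (transversal_projection metric H4 interp x x2 c y0 a D)
    as (p & y & Ea & Op & Y1 & Y2 & Fx1 & Fx2); [lra|easy..|].
  pose proof (metric_tri metric p0 c x). pose proof (metric_tri metric p0 c x2).
  assert (P1 : 4 * A + 100 * delta <= d p x) by lra.
  assert (P2 : 4 * A + 100 * delta <= d p x2) by lra.
  assert (disp : forall k, (k < 2 ^ I)%nat -> d p (act (pow g k) p) <= 36 * delta).
  { intros k Hk. pose proof (power_displacement_le n m p k ltac:(lia) Op P1 P2).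
    specialize (small k Hk). lra. }
  exists p, y. split; [easy | split; [easy|]].
  assert (base : forall k, (2 ^ I <= k < m)%nat -> gprod d p y (act (pow g k) y) <= 3 * delta).
  { intros k Hk. destruct (ends_move n k m ltac:(lia)) as [M1 M2].
    apply (transversal_gprod metric delta_pos H4 (act (pow g k)) (act_dist iso _) x x2 p y A); auto.
    apply Rle_trans with (INR k * l); [|apply power_displacement_ge].
    apply Rle_trans with (INR (2 ^ I) * l); [easy|].
    apply Rmult_le_compat_r; [easy | now apply le_INR]. }
  (* [i] counts the doublings allowed before [k] reaches the range of [base]; each costs [36 delta]
     of displacement and one [delta]. *)
  assert (double : forall i k, (k < m)%nat -> (2 ^ I <= 2 ^ i * k)%nat ->
    gprod d p y (act (pow g k) y) <= 3 * delta + 37 * delta * INR i).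
  { induction i as [|i IH]; intros k Hk Hik.
    { specialize (base k ltac:(simpl in Hik; lia)). simpl. lra. }
    rewrite S_INR. assert (0 <= 37 * delta * INR i) by (apply Rmult_le_pos; [lra | apply pos_INR]).
    destruct (Nat.le_gt_cases (2 ^ I) k) as [le | lt].
    { specialize (base k ltac:(lia)). lra. }
    pose proof (gprod_double metric H4 (act (pow g k)) (act_dist iso _) p y) as Hd.
    rewrite <- (act_mul iso), <- (gpow_add group) in Hd.
    specialize (disp k lt).
    specialize (IH (k + k)%nat ltac:(lia) ltac:(simpl in Hik; lia)). lra. }
  intros k Hk. specialize (double I k ltac:(lia) ltac:(nia)). lra.
Qed.

Lemma entropy_gt_of_small_translation (elem : non_elementary d) c :
  (1 <= I)%nat -> 0 <= c ->
  c * ((74 * INR I + 228) * delta + 6 * D) < (INR I - 1) * ln 2 ->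
  forall z, entropy_gt d act z c.
Proof.
  intros HI Hc Hlt.
  assert (D_nonneg : 0 <= D).
  { destruct (cocompact x x) as [h Hh]. pose proof (metric_nonneg metric x (act h x)). lra. }
  set (B := (3 + 37 * INR I) * delta).
  assert (B_pos : 0 <= B) by (unfold B; apply Rmult_le_pos; [pose proof (pos_INR I)|]; lra).
  (* [b0] adds to [B] two replacements of [w p] by [y] and a base point move by [g^i]; [b] adds
     [delta] for choosing a half and [36 delta] for replacing [s^-1 p] by [v]; [a] then makes the
     letters long enough for ping-pong. *)
  set (b0 := B + 2 * D + 36 * delta). set (b := b0 + 37 * delta).
  set (a := 2 * b + D + 40 * delta).
  destruct (transversal_axis elem a) as (p & y & Ea & disp & diverge).
  { unfold a, b, b0. lra. }
  destruct (cocompact y p) as [w Hw].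
  set (s := fun k => mul (pow g k) w).
  assert (s_apart : forall i j, (i < 2 ^ I)%nat -> (j < 2 ^ I)%nat -> i <> j ->
    gprod d p (act (s i) p) (act (s j) p) <= b0).
  { assert (aux : forall i j, (i < j)%nat -> (j < 2 ^ I)%nat ->
      gprod d p (act (s i) p) (act (s j) p) <= b0).
    { intros i j Hij Hj. unfold s.
      pose proof (gprod_move_base metric p (act (pow g i) p) (act (s i) p) (act (s j) p)) as E1.
      specialize (disp i ltac:(lia)). specialize (diverge (j - i)%nat ltac:(lia)). fold B in diverge.
      unfold s in E1. replace j with (i + (j - i))%nat in * by lia.
      rewrite (gpow_add group), <- (mul_assoc group), !(act_mul iso) in *.
      rewrite (gprod_isometry (act (pow g i)) (act_dist iso _)) in E1.
      replace (i + (j - i) - i)%nat with (j - i)%nat in * by lia.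
      pose proof (gprod_move_l metric p (act w p) y (act (pow g (j - i)) (act w p))) as E2.
      pose proof (gprod_move_r metric p y (act (pow g (j - i)) (act w p)) (act (pow g (j - i)) y)) as E3.
      rewrite (act_dist iso) in E3. rewrite (metric_sym metric (act w p) y) in *.
      unfold b0. lra. }
    intros i j Hi Hj ne. destruct (Nat.lt_gt_cases i j) as [[lt | lt] _]; [easy|..].
    - now apply aux.
    - rewrite (gprod_sym metric). now apply aux. }
  set (v := act (inv w) p).
  set (h := (2 ^ (I - 1))%nat).
  assert (Eh : (2 ^ I = h + h)%nat).
  { unfold h. replace I with (S (I - 1)) at 1 by lia. simpl. lia. }
  (* All the inverses send [p] near the single point [v], so that at most one
     index is bad and one of the two halves of [0, 2^I) is free of it. *)
  assert (half : exists q, (q + h <= 2 ^ I)%nat /\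
    forall k, (q <= k < q + h)%nat -> gprod d p (act (s k) p) v <= b0 + delta).
  { apply NNPP. intros no.
    assert (bad : forall q, (q + h <= 2 ^ I)%nat ->
      exists k, (q <= k < q + h)%nat /\ b0 + delta < gprod d p (act (s k) p) v).
    { intros q Hq. apply NNPP. intros no'. apply no. exists q. split; [easy|].
      intros k Hk. destruct (Rle_or_lt (gprod d p (act (s k) p) v) (b0 + delta)); [easy|].
      exfalso. apply no'. now exists k. }
    destruct (bad 0%nat) as (k1 & K1 & B1); [lia|].
    destruct (bad h) as (k2 & K2 & B2); [lia|].
    specialize (s_apart k1 k2 ltac:(lia) ltac:(lia) ltac:(lia)).
    rewrite (gprod_sym metric p (act (s k2) p)) in B2.
    destruct (H4 p (act (s k1) p) v (act (s k2) p)); lra. }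
  destruct half as (q & Hq & good).
  set (S := map s (seq q h)).
  assert (inS : forall t, In t S -> exists k, t = s k /\ (q <= k < q + h)%nat).
  { intros t Ht. apply in_map_iff in Ht as (k & <- & Hk). apply in_seq in Hk. now exists k. }
  assert (lenS : length S = h) by (unfold S; now rewrite length_map, length_seq).
  assert (disp_s : forall t, In t S -> 2 * b + 4 * delta <= d p (act t p) <= a + D + 36 * delta).
  { intros t Ht. destruct (inS t Ht) as (k & -> & Hk). unfold s. rewrite (act_mul iso).
    set (f := act (pow g k)). specialize (disp k ltac:(lia)). fold f in disp.
    assert (Ef : d (f p) (f y) = a) by (unfold f; now rewrite (act_dist iso)).
    assert (Ew : d (f y) (f (act w p)) <= D) by (unfold f; now rewrite (act_dist iso)).
    pose proof (metric_tri metric p (f p) (f (act w p))).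
    pose proof (metric_tri metric (f p) (f y) (f (act w p))).
    pose proof (metric_tri metric (f p) p (f y)).
    pose proof (metric_tri metric p (f (act w p)) (f y)).
    rewrite (metric_sym metric (f p) p) in *. rewrite (metric_sym metric (f (act w p)) (f y)) in *.
    unfold a in *. lra. }
  assert (h_pos : (1 <= h)%nat) by (unfold h; pose proof (Nat.pow_nonzero 2 (I - 1)); lia).
  apply (entropy_gt_of_words metric iso S p (a + D + 36 * delta)).
  - intros n. apply (NoDup_words group metric iso delta_pos H4 S p b).
    + unfold b, b0. lra.
    + intros t Ht. now apply disp_s.
    + intros t t' Ht Ht' ne. destruct (inS t Ht) as (k & -> & Hk), (inS t' Ht') as (k' & -> & Hk').
      specialize (s_apart k k' ltac:(lia) ltac:(lia) ltac:(congruence)). unfold b. lra.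
    + intros t t' Ht Ht'. destruct (inS t Ht) as (k & -> & Hk), (inS t' Ht') as (k' & -> & Hk').
      pose proof (gprod_move_l metric p (act (inv (s k)) p) v (act (s k') p)) as E.
      assert (Ev : act (s k) v = act (pow g k) p).
      { unfold s, v. rewrite (act_mul iso), <- (act_mul iso w).
        replace (mul w (inv w)) with e by (symmetry; apply group). now rewrite (act_e iso). }
      rewrite (act_inv_dist group iso), Ev in E.
      specialize (disp k ltac:(lia)). specialize (good k' Hk').
      rewrite (gprod_sym metric) in good. unfold b. lra.
    + apply NoDup_map_in; [apply seq_NoDup|]. intros i j _ _ Eij.
      apply (gpow_injective group g); [easy|]. now apply (mul_cancel_r group) in Eij.
  - intros t Ht. now apply disp_s.
  - lia.
  - unfold a, b, b0. lra.
  - easy.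
  - rewrite lenS. unfold h. rewrite pow_INR, ln_pow by (simpl; lra).
    rewrite minus_INR by lia. simpl INR.
    replace (1 + 1) with 2 by lra.
    replace (a + D + 36 * delta) with ((74 * INR I + 228) * delta + 6 * D)
      by (unfold a, b, b0, B; lra). easy.
Qed.

End Scale.
End SmallTranslation.

(** * Choice of the scale, numerical estimates and conclusion *)

Lemma least_power_of_two l c : 0 < l -> exists I, c <= INR (2 ^ I) * l /\
  forall k, (k < 2 ^ I)%nat -> INR k * l <= Rmax 0 (2 * c).
Proof.
  intros Hl. destruct (INR_archimed l c Hl) as [N HN].
  assert (Hex : c <= INR (2 ^ N) * l).
  { apply Rle_trans with (INR N * l); [lra|].
    apply Rmult_le_compat_r; [lra|]. apply le_INR. apply Nat.lt_le_incl, Nat.pow_gt_lin_r. lia. }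
  clear HN. induction N as [|N IH].
  - exists 0%nat. split; [easy|]. intros k Hk. replace k with 0%nat by (simpl in Hk; lia).
    simpl. rewrite Rmult_0_l. apply Rmax_l.
  - destruct (Rle_or_lt c (INR (2 ^ N) * l)) as [|Hlt]; [auto|].
    exists (S N). split; [easy|]. intros k Hk.
    apply Rle_trans with (2 * c); [|apply Rmax_r].
    assert (INR k * l <= INR (2 ^ S N) * l).
    { apply Rmult_le_compat_r; [lra | apply le_INR; lia]. }
    rewrite Nat.pow_succ_r', mult_INR in *. simpl (INR 2) in *. lra.
Qed.

Lemma quadratic_le_exp y : 0 <= y -> y * y / 4 <= exp y.
Proof.
  intros Hy.
  assert (E : exp y = exp (y / 2) * exp (y / 2)) by (rewrite <- exp_plus; f_equal; lra).
  rewrite E.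
  pose proof (exp_ineq1_le (y / 2)).
  apply Rle_trans with ((y / 2) * (y / 2)); [lra|].
  apply Rmult_le_compat; lra.
Qed.

(** Since [2 ^ I <= exp I] and the bound on [l] is at most [delta * exp (- M0 / 29)], an [I] below
    [M0 / 29] would give [2 ^ I * l < delta]. *)
Lemma exponent_lower_bound delta M0 l I :
  0 < delta -> 720 <= M0 ->
  l <= / 3 ^ 34 * delta * M0 * exp (- (4 / 29) * M0) ->
  10 * delta <= INR (2 ^ I) * l -> M0 / 29 <= INR I.
Proof.
  intros Hd HM Hl HI.
  assert (E2 : INR (2 ^ I) <= exp (INR I)).
  { rewrite pow_INR. replace (INR 2) with 2 by (simpl; lra). clear.
    induction I as [|I IH]; [simpl; rewrite exp_0; lra|].
    rewrite S_INR, exp_plus, Rmult_comm. simpl. pose proof (exp_ineq1_le 1).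
    apply Rmult_le_compat; try lra. apply pow_le. lra. }
  assert (EM : M0 * exp (- (4 / 29) * M0) <= exp (- (M0 / 29))).
  { replace (- (M0 / 29)) with (3 * (M0 / 29) + - (4 / 29) * M0) by lra. rewrite exp_plus.
    apply Rmult_le_compat_r; [left; apply exp_pos|].
    (* Here [720 <= M0] enters: [9 * 720 / (4 * 29 ^ 2)] exceeds 1, so [M0 <= exp (3 * M0 / 29)]. *)
    pose proof (quadratic_le_exp (3 * (M0 / 29)) ltac:(lra)).
    assert (720 * M0 <= M0 * M0) by (apply Rmult_le_compat_r; lra). lra. }
  assert (E3 : / 3 ^ 34 <= 1).
  { rewrite <- Rinv_1. apply Rinv_le_contravar; [lra | apply pow_R1_Rle; lra]. }
  assert (Hl' : l <= delta * exp (- (M0 / 29))).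
  { eapply Rle_trans; [exact Hl|].
    replace (/ 3 ^ 34 * delta * M0 * exp (- (4 / 29) * M0))
      with (/ 3 ^ 34 * (delta * (M0 * exp (- (4 / 29) * M0)))) by ring.
    assert (0 <= delta * (M0 * exp (- (4 / 29) * M0))).
    { pose proof (exp_pos (- (4 / 29) * M0)).
      apply Rmult_le_pos; [lra|]. apply Rmult_le_pos; lra. }
    apply Rle_trans with (1 * (delta * (M0 * exp (- (4 / 29) * M0)))).
    - now apply Rmult_le_compat_r.
    - rewrite Rmult_1_l. apply Rmult_le_compat_l; lra. }
  apply Rnot_lt_le. intros Hlt.
  assert (exp (INR I) * exp (- (M0 / 29)) < 1).
  { rewrite <- exp_plus, <- exp_0. apply exp_increasing. lra. }
  assert (INR (2 ^ I) * l <= exp (INR I) * (delta * exp (- (M0 / 29)))).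
  { apply Rle_trans with (INR (2 ^ I) * (delta * exp (- (M0 / 29)))).
    - apply Rmult_le_compat_l; [apply pos_INR | easy].
    - apply Rmult_le_compat_r; [|easy].
      pose proof (exp_pos (- (M0 / 29))). apply Rmult_le_pos; lra. }
  assert (delta * (exp (INR I) * exp (- (M0 / 29))) < delta * 1) by (now apply Rmult_lt_compat_l).
  lra.
Qed.

Theorem theorem5p3
  (X : Type) (d : X -> X -> R) (delta D : R)
  (G : Type) (mul : G -> G -> G) (inv : G -> G) (e : G) (act : G -> X -> X) :
  0 < delta ->
  hyperbolic_space d delta ->
  non_elementary d ->
  is_group mul inv e ->
  isometric_action mul e d act ->
  proper_action d act ->
  quotient_diam_le d act D ->
  let M0 := Rmax (20 * (D / delta + 2)) 720 in
  (forall x : X, entropy_gt d act x (1 / (750 * delta)))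
  \/
  (forall g : G, g <> e -> ~ finite_order mul e g ->
     forall x : X,
       transl_length_gt mul e d act x g
         (/ 3 ^ 34 * delta * M0 * exp (- (4 / 29) * M0))).
Proof.
  intros delta_pos (metric & geod & _ & thin) elem group iso prop diam M0.
  match goal with |- _ \/ ?B => destruct (classic B) as [|no]; [now right | left] end.
  apply not_all_ex_not in no as [g no]. apply imply_to_and in no as [_ no].
  apply imply_to_and in no as [inf no]. apply not_all_ex_not in no as [x no].
  pose proof (thin_four_point metric geod thin) as H4.
  pose proof (geodesic_interpolating metric geod) as interp.
  (* The quotient distance is an infimum, so one [delta] is spent to realise it by a group
     element. *)
  assert (cocompact : forall y z, exists h, d y (act h z) <= D + delta).
  { intros y z. destruct (diam y z delta delta_pos) as [h Hh]. exists h. lra. }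
  destruct (fekete (fun n => d x (act (gpow mul e g n) x))) as (l & l_nonneg & lower & upper).
  { intros. apply (metric_nonneg metric). }
  { intros. apply (act_gpow_subadditive group metric iso). }
  assert (l_small : l <= / 3 ^ 34 * delta * M0 * exp (- (4 / 29) * M0)).
  { apply Rnot_lt_le. intros Hl. apply no. exists l. split; [|easy].
    intros eps Heps. destruct (upper (eps / 2)) as [N HN]; [lra|].
    exists N. intros n Hn. specialize (HN (S n) ltac:(lia)). specialize (lower (S n)).
    set (u := d x (act (gpow mul e g (S n)) x)) in *.
    assert (0 < INR (S n)) by (apply lt_0_INR; lia).
    assert (l <= u / INR (S n)).
    { apply Rmult_le_reg_l with (INR (S n)); [easy|].
      replace (INR (S n) * (u / INR (S n))) with u by (field; lra). easy. }
    assert (u / INR (S n) <= l + eps / 2).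
    { apply Rmult_le_reg_l with (INR (S n)); [easy|].
      replace (INR (S n) * (u / INR (S n))) with u by (field; lra). easy. }
    unfold Rdist. rewrite Rabs_right; lra. }
  pose proof (translation_length_pos metric delta_pos H4 interp group iso prop cocompact inf
    l_nonneg upper) as l_pos.
  destruct (least_power_of_two l (10 * delta) l_pos) as (I & large & small).
  rewrite Rmax_right in small by lra.
  pose proof (exponent_lower_bound delta M0 l I delta_pos (Rmax_r _ _) l_small large) as HI.
  pose proof (Rmax_l (20 * (D / delta + 2)) 720 : _ <= M0).
  pose proof (Rmax_r (20 * (D / delta + 2)) 720 : _ <= M0).
  apply (entropy_gt_of_small_translation metric delta_pos H4 interp group iso prop cocompact inf
    l_nonneg lower upper large); auto.
  - intros k Hk. specialize (small k Hk). lra.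
  - destruct I; [simpl in HI; lra | lia].
  - unfold Rdiv. rewrite Rmult_1_l. left. apply Rinv_0_lt_compat. lra.
  (* With [D / delta <= M0 / 20 - 2] and [M0 <= 29 I], the left side is at most
     [(82.7 I + 222) / 750], which is below [(I - 1) / 2] as [I >= 720 / 29]. *)
  - replace (1 / (750 * delta) * ((74 * INR I + 228) * delta + 6 * (D + delta)))
      with ((74 * INR I + 234 + 6 * (D / delta)) / 750) by (field; lra).
    pose proof ln_lt_2.
    assert ((INR I - 1) * / 2 <= (INR I - 1) * ln 2) by (apply Rmult_le_compat_l; lra).
    lra.
Qed.
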